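(* Assume that the bounded bilinear form $b:Y\times V\to\mathbb{R}$ satisfies the following: there is a constant $C_b>0$ with $$C_b\|y\|_Y\le \sup_{0\ne v\in V}\frac{b(y,v)}{\|v\|_V}\quad\forall y\in Y,\qquad\text{and}\qquad \{v\in V: b(y,v)=0\ \text{for all } y\in Y\}=\{0\}.$$ Then the optimal control problem $$\min\{J(\mathsf y,\mathsf u):(\mathsf y,\mathsf u)\in Y\times U_{ad}\}\quad\text{subject to}\quad b(\mathsf y,v)=\langle D\mathsf u,v\rangle_{V',V}\ \ \forall v\in V$$ admits a unique solution $(\bar{\mathsf y},\bar{\mathsf u})\in Y\times U_{ad}$.
   Context: $U,Y,V,\mathcal Y$ are real Hilbert spaces; $U_{ad}\subseteq U$ is non-empty, bounded, closed and convex; $b:Y\times V\to\mathbb{R}$ is a bounded bilinear form; $O:Y\to\mathcal Y$ and $D:U\to V'$ are bounded linear operators; $\mathsf y_d\in\mathcal Y$ and $\alpha>0$ are given. The cost functional is $$J(\mathsf y,\mathsf u):=\tfrac12\|O\mathsf y-\mathsf y_d\|_{\mathcal Y}^2+\tfrac{\alpha}{2}\|\mathsf u\|_U^2 .$$ *)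

(* Defs.v *)
From HB Require Import structures.
From mathcomp Require Import all_boot all_order all_algebra.
From mathcomp Require Import all_classical all_reals all_analysis.
Set Implicit Arguments.
Unset Strict Implicit.
Unset Printing Implicit Defensive.
Import Order.TTheory GRing.Theory Num.Theory.
Import numFieldNormedType.Exports.
Local Open Scope classical_set_scope.
Local Open Scope ring_scope.

(* A real Hilbert space is a Banach space whose norm comes from a symmetric
   positive definite bilinear form. *)
HB.mixin Record CompleteNormedModule_isHilbert (R : realType) V
    & CompleteNormedModule R V := {
  inner : {dot V for (@idfun R)};
  innerxx : forall x : V, inner x x = `|x| ^+ 2
}.

#[short(type="hilbertType")]
HB.structure Definition Hilbert (R : realType) :=
  {V of CompleteNormedModule R V & CompleteNormedModule_isHilbert R V}.

Section dual_space.
Context {R : realType} (V : normedModType R).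

Definition dual_pred : {pred V -> R} :=
  mem [set f : V -> R | linear f /\ continuous f].

Record dual := Dual { dual_fun :> V -> R; _ : dual_fun \in dual_pred }.

HB.instance Definition _ := [isSub for dual_fun].
HB.instance Definition _ := [Choice of dual by <:].

Let dual_submod_closed : submod_closed dual_pred.
Proof.
split=> [|a f g].
  rewrite inE; split=> [c x y|x]; first by rewrite /= scaler0 addr0.
  exact: cst_continuous.
rewrite !inE => -[lf cf] [lg cg]; split=> [c x y|x].
  rewrite !fctE lf lg !scalerDr addrACA; congr (_ + _ + _).
  by rewrite !scalerA mulrC.
by apply: continuousD; [apply: continuousZl_tmp; exact: cf|exact: cg].
Qed.

HB.instance Definition _ := GRing.isSubmodClosed.Build _ _ dual_pred
  dual_submod_closed.
HB.instance Definition _ := [SubChoice_isSubLmodule of dual by <:].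

Let dual_linear (f : dual) : linear f.
Proof. by case: f => f fP; have := fP; rewrite inE => -[]. Qed.

HB.instance Definition _ (f : dual) :=
  GRing.isLinear.Build R V R _ (dual_fun f) (dual_linear f).

Lemma dual_continuous (f : dual) : continuous f.
Proof. by case: f => f fP; have := fP; rewrite inE => -[]. Qed.

Lemma dualDE (f g : dual) v : (f + g) v = f v + g v. Proof. by []. Qed.
Lemma dualZE a (f : dual) v : (a *: f) v = a * f v. Proof. by []. Qed.

(* If V = {0} the set is empty and its sup is 0, as wanted. *)
Definition dual_norm (f : dual) : R :=
  sup [set `|f v| / `|v| | v in [set v | v != 0]].

Lemma dual_bounded (f : dual) : exists C, forall v, `|f v| <= C * `|v|.
Proof.
have /linear_bounded_continuous/linear_boundedP := @dual_continuous f.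
by move=> /pinfty_ex_gt0[C _ fC]; exists C.
Qed.

Lemma dual_norm_ge (f : dual) v : `|f v| <= dual_norm f * `|v|.
Proof.
have [->|v0] := eqVneq v 0; first by rewrite linear0 !normr0 mulr0.
rewrite -ler_pdivrMr ?normr_gt0//; apply: ub_le_sup; last by exists v.
have [C fC] := dual_bounded f; exists C => _ [w w0 <-].
by rewrite ler_pdivrMr ?normr_gt0.
Qed.

Lemma dual_norm_le (f : dual) C : 0 <= C ->
  (forall v, `|f v| <= C * `|v|) -> dual_norm f <= C.
Proof.
move=> C0 fC; rewrite /dual_norm; set A := (X in sup X).
have [->|/set0P A0] := eqVneq A set0; first by rewrite sup0.
apply: ge_sup => // _ [v v0 <-].
by rewrite ler_pdivrMr ?normr_gt0.
Qed.

Lemma dual_norm_ge0 (f : dual) : 0 <= dual_norm f.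
Proof.
have [[v v0]|V0] := pselect (exists v : V, v != 0); last first.
  suff -> : dual_norm f = sup set0 by rewrite sup0.
  congr sup; apply/seteqP; split=> // x [v v0 _].
  by apply: V0; exists v.
have := le_trans (normr_ge0 _) (dual_norm_ge f v).
by rewrite pmulr_lge0 ?normr_gt0.
Qed.

Let dual_normD (f g : dual) : dual_norm (f + g) <= dual_norm f + dual_norm g.
Proof.
apply: dual_norm_le => [|v]; first by rewrite addr_ge0 ?dual_norm_ge0.
by rewrite mulrDl (le_trans (ler_normD _ _))// lerD ?dual_norm_ge.
Qed.

Let dual_normZ_le a (f : dual) : dual_norm (a *: f) <= `|a| * dual_norm f.
Proof.
apply: dual_norm_le => [|v]; first by rewrite mulr_ge0 ?dual_norm_ge0.
by rewrite dualZE normrM -mulrA ler_wpM2l ?dual_norm_ge.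
Qed.

Let dual_normZ a (f : dual) : dual_norm (a *: f) = `|a| * dual_norm f.
Proof.
apply/eqP; rewrite eq_le dual_normZ_le/=.
have [->|a0] := eqVneq a 0; first by rewrite normr0 mul0r dual_norm_ge0.
rewrite -ler_pdivlMl ?normr_gt0// -normfV.
by rewrite (le_trans _ (dual_normZ_le _ _))// scalerA mulVf// scale1r.
Qed.

Let dual_norm0 (f : dual) : dual_norm f = 0 -> f = 0.
Proof.
move=> f0; apply/val_inj/funext => v /=.
apply/eqP; rewrite -normr_le0.
by have := dual_norm_ge f v; rewrite f0 mul0r.
Qed.

HB.instance Definition _ := Lmodule_isNormed.Build R dual
  dual_normD dual_normZ dual_norm0.

End dual_space.

Section control_problem.
Context {R : realType}.

Definition bounded_operator (E F : normedModType R) (f : {linear E -> F}) :=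
  exists C : R, forall x, `|f x| <= C * `|x|.

Definition bounded_bilinear (E F : normedModType R) (b : {bilinear E -> F -> R}) :=
  exists C : R, forall x y, `|b x y| <= C * `|x| * `|y|.

(* The set under the sup is bounded above when [b] is a bounded form, so the
   real-valued sup is the mathematical one; it is 0 when V = {0}. *)
Definition inf_sup (Y V : normedModType R) (b : {bilinear Y -> V -> R}) (C : R) :=
  forall y, C * `|y| <= sup [set b y v / `|v| | v in [set v | v != 0]].

Definition nondegenerate_right (Y V : normedModType R)
    (b : {bilinear Y -> V -> R}) :=
  [set v | forall y, b y v = 0] = [set 0].

Definition cost (U Y Z : hilbertType R) (O : {linear Y -> Z}) (yd : Z)
    (alpha : R) (p : Y * U) : R :=
  1 / 2 * `|O p.1 - yd| ^+ 2 + alpha / 2 * `|p.2| ^+ 2.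

Definition admissible (U Y V : hilbertType R) (Uad : set U)
    (b : {bilinear Y -> V -> R}) (D : {linear U -> dual V}) : set (Y * U) :=
  [set p | Uad p.2 /\ forall v, b p.1 v = D p.2 v].

Definition minimizer T (J : T -> R) (A : set T) (x : T) :=
  A x /\ forall z, A z -> J x <= J z.

End control_problem.

(* Main.v *)
(* Everything rests on minimising a strongly midpoint-convex functional over a
   closed set in a complete space: midpoint convexity makes minimising sequences
   Cauchy, so no weak compactness is needed. Applied
   to [a x x - 2 f x] this yields the Lax-Milgram theorem for symmetric forms,
   hence Riesz representation and, through least squares, unique solvability of
   the state equation with a bounded linear solution operator [S]. Applied to the
   reduced cost [u |-> J (S u, u)], which the term [alpha / 2 * |u|^2] makes
   strongly convex, it yields the optimal control. *)
Require Import Defs.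
From HB Require Import structures.
From mathcomp Require Import all_boot all_order all_algebra.
From mathcomp Require Import all_classical all_reals all_analysis.
From mathcomp Require Import ring lra.
Set Implicit Arguments.
Unset Strict Implicit.
Unset Printing Implicit Defensive.
Import Order.TTheory GRing.Theory Num.Theory.
Import numFieldNormedType.Exports.
Local Open Scope classical_set_scope.
Local Open Scope ring_scope.

(** * Strongly convex minimisation and the symmetric Lax-Milgram theorem *)

(** A midpoint has value at least the infimum [mu], so [c * |x - y|^2] is at most the mean excess of
    [J x] and [J y] over [mu]. This one inequality, [gap], gives both Cauchy minimising sequences
    and uniqueness. *)
Lemma strongly_convex_minimizer (R : realType) (H : completeNormedModType R)
    (C : set H) (J : H -> R) (c m : R) :
  C !=set0 -> closed C -> continuous J -> 0 < c ->
  (forall x, C x -> m <= J x) ->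
  (forall x y, C x -> C y -> C (2^-1 *: (x + y)) /\
     J (2^-1 *: (x + y)) <= (J x + J y) / 2 - c * `|x - y| ^+ 2) ->
  exists! x, minimizer J C x.
Proof.
move=> C0 C_closed J_cont c0 Jm J_mid.
have J_inf : has_inf (J @` C).
  split; first by case: C0 => x Cx; exists (J x), x.
  by exists m => _ [x Cx <-]; exact: Jm.
pose mu := inf (J @` C).
have mu_le x : C x -> mu <= J x.
  by move=> Cx; apply: ge_inf; [exact: J_inf.2|exists x].
have gap x y : C x -> C y -> c * `|x - y| ^+ 2 <= (J x + J y) / 2 - mu.
  move=> Cx Cy; have [Cxy Jxy] := J_mid _ _ Cx Cy.
  by have := mu_le _ Cxy; lra.
have min_inf x : minimizer J C x -> J x = mu.
  move=> [Cx xmin]; apply/eqP; rewrite eq_le mu_le// andbT.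
  apply: lb_le_inf; first by exists (J x), x.
  by move=> _ [z Cz <-]; exact: xmin.
have /choice[x_ x_P] (n : nat) : exists x, C x /\ J x < mu + n.+1%:R^-1.
  have n0 : 0 < n.+1%:R^-1 :> R by rewrite invr_gt0.
  by have [_ [x Cx <-] Jx] := inf_adherent n0 J_inf; exists x.
have x_cauchy : cauchy (x_ @ \oo).
  apply/cauchy_ballP => e e0; rewrite near_map2; near=> i j.
  rewrite -ball_normE /= -(@ltr_pXn2r _ 2) ?nnegrE ?(ltW e0)//.
  rewrite -(ltr_pM2l c0).
  have [Ci Ji] := x_P i; have [Cj Jj] := x_P j.
  (* Each excess is below [c * e ^+ 2] for large indices, hence so is their mean in [gap]. *)
  have hi : i.+1%:R^-1 < c * e ^+ 2.
    by near: i; apply: near_infty_natSinv_lt (PosNum _); rewrite mulr_gt0 ?exprn_gt0.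
  have hj : j.+1%:R^-1 < c * e ^+ 2.
    by near: j; apply: near_infty_natSinv_lt (PosNum _); rewrite mulr_gt0 ?exprn_gt0.
  apply: le_lt_trans (gap _ _ Ci Cj) _.
  move: (ltW Ji) (ltW Jj) hi hj; move: (J _) (J _) (_^-1) (_^-1) (c * _) => *.
  by lra.
have [x x_x] : exists x : H, x_ @ \oo --> x.
  by apply/cvg_ex; exact: cauchy_cvg x_cauchy.
have Cx : C x.
  by apply: (closed_cvg C C_closed _ x x_x); apply: nearW => n; exact: (x_P n).1.
have Jx_x : J (x_ n) @[n --> \oo] --> J x by apply: cvg_comp x_x _; exact: J_cont.
have Jx : J x <= mu.
  apply/ler_addgt0Pr => e e0.
  apply: (closed_cvg [set t | t <= mu + e] (@closed_le _ _) _ _ Jx_x).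
  near=> n; apply/ltW/(lt_trans (x_P n).2); rewrite ltrD2l.
  by near: n; exact: near_infty_natSinv_lt (PosNum e0).
have x_min : minimizer J C x.
  by split=> // z Cz; apply: (le_trans Jx); exact: mu_le.
exists x; split=> // y ymin.
apply/eqP; rewrite -subr_eq0 -normr_eq0 -sqrf_eq0 eq_le sqr_ge0 andbT.
rewrite -(pmulr_rle0 _ c0); apply: (le_trans (gap _ _ Cx ymin.1)).
by rewrite !min_inf//; lra.
Unshelve. all: by end_near. Qed.

Lemma bounded_operator_continuous (R : realType) (E F : normedModType R)
    (f : {linear E -> F}) : bounded_operator f -> continuous f.
Proof.
move=> [K fK]; apply/linear_bounded_continuous/linear_boundedP.
near=> r => x; apply: le_trans (fK x) _; apply: ler_wpM2r => //.
Unshelve. all: by end_near. Qed.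

Lemma cvg_sqr_norm (R : realType) (V : normedModType R) T (F : set_system T)
    {FF : Filter F} (f : T -> V) (l : V) :
  f @ F --> l -> `|f x| ^+ 2 @[x --> F] --> `|l| ^+ 2.
Proof. by move=> /cvg_norm fl; rewrite expr2; exact: cvgM. Qed.

(** The equation is the vanishing of the first variation of [a x x - 2 * f x] at its minimiser. *)
Lemma symmetric_lax_milgram (R : realType) (H : completeNormedModType R)
    (a : H -> H -> R) (f : {linear H -> R}) (c : R) :
  (forall y, linear (a ^~ y)) -> (forall x y, a x y = a y x) ->
  continuous (fun x => a x x) ->
  0 < c -> (forall x, c * `|x| ^+ 2 <= a x x) ->
  bounded_operator f -> exists x, forall y, a x y = f y.
Proof.
move=> a_lin aC a_cont c0 a_coercive f_bounded.
have aDl x y z : a (x + y) z = a x z + a y z.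
  by have := a_lin z 1 x y; rewrite !scale1r.
have a0l z : a 0 z = 0.
  by have := aDl 0 0 z; rewrite addr0; lra.
have aZl k x z : a (k *: x) z = k * a x z.
  by have := a_lin z k x 0; rewrite !addr0 a0l addr0.
have aDr x y z : a z (x + y) = a z x + a z y by rewrite ![a z _]aC aDl.
have aZr k x z : a z (k *: x) = k * a z x by rewrite ![a z _]aC aZl.
have fZ k x : f (k *: x) = k * f x by rewrite linearZ.
pose J x := a x x - 2 * f x.
have J_cont : continuous J.
  move=> x; apply: cvgB; first exact: a_cont.
  by apply: cvgMl_tmp; exact: bounded_operator_continuous.
have [K fK] := f_bounded.
(* Complete the square in [c * t^2 - 2 * K * t] with [t = |x|]. *)
have J_ge x : - (K ^+ 2 / c) <= J x.
  have fx : f x <= K * `|x| by apply: le_trans (fK x); exact: ler_norm.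
  have := a_coercive x; rewrite /J.
  have : 0 <= c * (`|x| - K / c) ^+ 2 by rewrite mulr_ge0 ?sqr_ge0// ltW.
  have -> : c * (`|x| - K / c) ^+ 2 = c * `|x| ^+ 2 - 2 * K * `|x| + K ^+ 2 / c.
    by field; rewrite gt_eqF.
  lra.
(* The linear part cancels, and the convexity gap is exactly [a (x - y) (x - y) / 4]. *)
have J_mid x y : J (2^-1 *: (x + y)) <= (J x + J y) / 2 - c / 4 * `|x - y| ^+ 2.
  have := a_coercive (x - y).
  rewrite /J -scaleN1r !(aZl, aZr, aDl, aDr, fZ, linearD) (aC y x) scaleN1r.
  lra.
have [x [[_ xmin] _]] : exists! x, minimizer J setT x.
  apply: (@strongly_convex_minimizer _ _ _ J (c / 4) (- (K ^+ 2 / c))) => //.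
  - by exists 0.
  - by rewrite divr_gt0.
exists x => y; apply/eqP; rewrite -subr_eq0 -sqrf_eq0 eq_le sqr_ge0 andbT.
set d := _ - _; set q := a y y.
have q0 : 0 < q + 1.
  by rewrite ltr_wpDl// (le_trans _ (a_coercive y))// mulr_ge0 ?sqr_ge0 ?ltW.
(* Along [y] the optimal step would be [- d / q]; the [+ 1] avoids dividing by zero. The change of
   [J] is [- d^2 * (q + 2) / (q + 1)^2], so minimality forces [d = 0]. *)
have := xmin (x + - (d / (q + 1)) *: y) I.
rewrite /J !(aZl, aZr, aDl, aDr, fZ, linearD) (aC y x) -/q.
rewrite -subr_ge0 => h.
have {h} : 0 <= - d ^+ 2 * (q + 2) / (q + 1) ^+ 2.
  apply: le_trans h _; rewrite le_eqVlt; apply/orP; left; apply/eqP.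
  by rewrite /d; field; rewrite gt_eqF.
rewrite pmulr_lge0 ?invr_gt0 ?exprn_gt0// pmulr_lge0 ?oppr_ge0//.
lra.
Qed.

(** * Geometry of the inner product *)

Lemma innerC (R : realType) (V : hilbertType R) (x y : V) : inner x y = inner y x.
Proof. by rewrite hermC expr0 mul1r. Qed.

Lemma innerDl (R : realType) (V : hilbertType R) (x y z : V) :
  inner (x + y) z = inner x z + inner y z.
Proof. exact: linearDl. Qed.

Lemma innerBl (R : realType) (V : hilbertType R) (x y z : V) :
  inner (x - y) z = inner x z - inner y z.
Proof. exact: linearBl. Qed.

Lemma innerZl (R : realType) (V : hilbertType R) (k : R) (x y : V) :
  inner (k *: x) y = k * inner x y.
Proof. exact: linearZl_LR. Qed.

Lemma sqr_normB (R : realType) (V : hilbertType R) (x y : V) :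
  `|x - y| ^+ 2 = `|x| ^+ 2 - 2 * inner x y + `|y| ^+ 2.
Proof. by rewrite -!innerxx hnormB expr0 mul1r /=; ring. Qed.

Lemma sqr_normD (R : realType) (V : hilbertType R) (x y : V) :
  `|x + y| ^+ 2 = `|x| ^+ 2 + 2 * inner x y + `|y| ^+ 2.
Proof. by rewrite -!innerxx hnormD expr0 mul1r /=; ring. Qed.

(** The parallelogram law, solved for the midpoint term. *)
Lemma sqr_norm_midpoint (R : realType) (V : hilbertType R) (x y : V) :
  `|2^-1 *: (x + y)| ^+ 2 = (`|x| ^+ 2 + `|y| ^+ 2) / 2 - 4^-1 * `|x - y| ^+ 2.
Proof.
by rewrite normrZ exprMn sqr_normB sqr_normD ger0_norm ?invr_ge0//; field.
Qed.

Lemma inner_eq0 (R : realType) (V : hilbertType R) (x : V) :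
  (forall v, inner x v = 0) -> x = 0.
Proof.
by move=> /(_ x)/eqP; rewrite innerxx sqrf_eq0 normr_eq0 => /eqP.
Qed.

(** One-sided Cauchy-Schwarz: expand the square of the norm of [|y| *: x - |x| *: y]. *)
Lemma inner_le_norm (R : realType) (V : hilbertType R) (x y : V) :
  inner x y <= `|x| * `|y|.
Proof.
have [->|x0] := eqVneq x 0; first by rewrite linear0l normr0 mul0r.
have [->|y0] := eqVneq y 0; first by rewrite linear0r normr0 mulr0.
have xy0 : 0 < `|x| * `|y| by rewrite mulr_gt0 ?normr_gt0.
rewrite -(ler_pM2l xy0) -subr_ge0.
have -> : `|x| * `|y| * (`|x| * `|y|) - `|x| * `|y| * inner x y =
          2^-1 * `| `|y| *: x - `|x| *: y | ^+ 2.
  by rewrite sqr_normB !normrZ !normr_id innerZl (innerC x (_ *: _)) innerZl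
             (innerC y); field.
by rewrite mulr_ge0 ?sqr_ge0.
Qed.

(** * Riesz representation and the state equation *)

Lemma riesz_representation (R : realType) (V : hilbertType R) (f : {linear V -> R}) :
  bounded_operator f -> exists w, forall v, inner w v = f v.
Proof.
apply: (@symmetric_lax_milgram _ _ _ _ 1) => //.
- by move=> y k u v; rewrite linearPl.
- exact: innerC.
- under eq_fun do rewrite innerxx.
  by move=> x; exact: cvg_sqr_norm.
- by move=> x; rewrite mul1r innerxx.
Qed.

(** Each [b y] has a Riesz representative [B y]; uniqueness of representatives makes [B] linear. *)
Lemma bilinear_form_operator (R : realType) (Y V : hilbertType R)
    (b : {bilinear Y -> V -> R}) : bounded_bilinear b ->
  exists2 B : {linear Y -> V}, bounded_operator B &
    forall y v, inner (B y) v = b y v.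
Proof.
move=> [C bC].
have /choice[B BE] (y : Y) : exists w, forall v, inner w v = b y v.
  by apply: (@riesz_representation _ _ (b y)); exists (C * `|y|) => v; exact: bC.
have B_lin : linear B.
  move=> k x y; apply/eqP; rewrite -subr_eq0; apply/eqP/inner_eq0 => v.
  by rewrite innerBl innerDl innerZl !BE linearPl subrr.
pose B' : {linear Y -> V} := HB.pack B (GRing.isLinear.Build _ _ _ _ B B_lin).
(* The sign of [C] is unknown, hence [|C|]. The bound comes from testing [b y] with [v = B y]. *)
exists B' => //; exists `|C| => y.
have [->|By0] := eqVneq (B' y) 0; first by rewrite normr0 mulr_ge0.
have By_gt0 : 0 < `|B' y| by rewrite normr_gt0.
rewrite -(ler_pM2r By_gt0) -expr2 -innerxx BE.
apply: le_trans (ler_norm _) _; apply: le_trans (bC _ _) _.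
by rewrite -!mulrA; apply: ler_wpM2r; [rewrite mulr_ge0|exact: ler_norm].
Qed.

(** The inf-sup condition freed of its [sup]. The hypothesis [0 <= K] covers a trivial [V], where
    the sup of the empty set is 0. *)
Lemma inf_sup_le (R : realType) (Y V : normedModType R)
    (b : {bilinear Y -> V -> R}) (C K : R) (y : Y) :
  inf_sup b C -> 0 <= K -> (forall v, b y v <= K * `|v|) -> C * `|y| <= K.
Proof.
move=> bC K0 byK; apply: le_trans (bC y) _; set A := (X in sup X).
have [->|/set0P A0] := eqVneq A set0; first by rewrite sup0.
apply: ge_sup => // _ [v v0 <-].
by rewrite ler_pdivrMr ?normr_gt0.
Qed.

(* With [B] the Riesz representative of [b], the form [<B y, B y'>] is coercive
   by the inf-sup condition, and its normal equation [B^* (B y - w) = 0] forces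
   [B y = w] by nondegeneracy. *)
Lemma inf_sup_solvable (R : realType) (Y V : hilbertType R)
    (b : {bilinear Y -> V -> R}) (Cb : R) (f : {linear V -> R}) :
  bounded_bilinear b -> 0 < Cb -> inf_sup b Cb -> nondegenerate_right b ->
  bounded_operator f -> exists y, forall v, b y v = f v.
Proof.
move=> b_bounded Cb0 bCb b_nondeg /riesz_representation[w wE].
have [B B_bounded BE] := bilinear_form_operator b_bounded.
have B_ge y : Cb * `|y| <= `|B y|.
  by apply: (inf_sup_le bCb) => // v; rewrite -BE; exact: inner_le_norm.
(* The right-hand side [<B y, w>] of the normal equation equals [b y w]. *)
have wB_lin : linear (fun y => b y w) by move=> k x y; rewrite linearPl.
pose g : {linear Y -> R} :=
  HB.pack (fun y => b y w) (GRing.isLinear.Build _ _ _ _ _ wB_lin).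
have g_bounded : bounded_operator g.
  have [C bC] := b_bounded; exists (C * `|w|) => y.
  by rewrite mulrAC; exact: bC.
have [|||||y yP] :=
  @symmetric_lax_milgram _ _ (fun y y' => inner (B y) (B y')) g (Cb ^+ 2)
    _ _ _ _ _ g_bounded.
- by move=> y k u v; rewrite linearP innerDl innerZl.
- by move=> x y; exact: innerC.
- under eq_fun do rewrite innerxx.
  by move=> x; apply: cvg_sqr_norm; exact: bounded_operator_continuous.
- by rewrite exprn_gt0.
- move=> x; rewrite innerxx -exprMn ler_pXn2r ?nnegrE//.
  by rewrite mulr_ge0// ltW.
exists y => v; rewrite -wE -BE; suff -> : B y = w by [].
apply/eqP; rewrite -subr_eq0; apply/eqP.
(* The normal equation makes [B y - w] orthogonal to the range of [B]. *)
have : [set v | forall y, b y v = 0] (B y - w).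
  by move=> z; rewrite linearBr -BE innerC yP subrr.
by rewrite b_nondeg.
Qed.

(** The inf-sup condition gives uniqueness of the state, and uniqueness gives linearity of [S]. The
    equivalence lets the constraint be replaced by [y = S u]. *)
Lemma solution_operator (R : realType) (U Y V : hilbertType R)
    (b : {bilinear Y -> V -> R}) (Cb : R) (D : {linear U -> dual V}) :
  bounded_bilinear b -> 0 < Cb -> inf_sup b Cb -> nondegenerate_right b ->
  bounded_operator D ->
  exists2 S : {linear U -> Y}, bounded_operator S &
    forall u y, (forall v, b y v = D u v) <-> y = S u.
Proof.
move=> b_bounded Cb0 bCb b_nondeg [C DC].
have D_le u v : D u v <= `|D u| * `|v|.
  by apply: le_trans (ler_norm _) _; exact: dual_norm_ge.
have /choice[S SE] (u : U) : exists y, forall v, b y v = D u v.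
  apply: (inf_sup_solvable b_bounded Cb0 bCb b_nondeg).
  by exists `|D u| => v; exact: dual_norm_ge.
have b_inj y : (forall v, b y v = 0) -> y = 0.
  move=> by0; apply/eqP; rewrite -normr_le0 -(pmulr_rle0 _ Cb0).
  by apply: (inf_sup_le bCb) => // v; rewrite by0 mul0r.
have S_uniq u y : (forall v, b y v = D u v) -> y = S u.
  move=> yE; apply/eqP; rewrite -subr_eq0; apply/eqP/b_inj => v.
  by rewrite linearBl yE SE subrr.
have S_lin : linear S.
  move=> k x y; apply/esym/S_uniq => v.
  by rewrite linearPl !SE linearP.
pose S' : {linear U -> Y} := HB.pack S (GRing.isLinear.Build _ _ _ _ S S_lin).
exists S'; last first.
  by move=> u y; split=> [|->]; [exact: S_uniq|exact: SE].
(* Chain [Cb * |S u| <= |D u| <= C * |u|]. *)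
exists (C / Cb) => u; rewrite mulrAC ler_pdivlMr// mulrC.
apply: le_trans (DC u); apply: (inf_sup_le bCb) => // v.
by rewrite SE.
Qed.

(** * The reduced control problem *)

Lemma convex_midpoint (R : realType) (U : lmodType R) (A : set U) (x y : U) :
  convex_set A -> A x -> A y -> A (2^-1 *: (x + y)).
Proof.
move=> A_convex Ax Ay.
have half0 : 0 <= 2^-1 :> R by rewrite invr_ge0.
have half1 : 2^-1 <= 1 :> R by rewrite invf_le1// ler1n.
have /set_mem := A_convex x y (Itv01 half0 half1) (mem_set Ax) (mem_set Ay).
rewrite /conv/= /unstable.onem.
have -> : 1 - 2^-1 = 2^-1 :> R by lra.
by rewrite -scalerDr.
Qed.

Theorem theorem3p1 (R : realType) (U Y V Z : hilbertType R)
    (Uad : set U)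
    (Uad_neq0 : Uad !=set0) (Uad_bounded : bounded_set Uad)
    (Uad_closed : closed Uad) (Uad_convex : convex_set Uad)
    (b : {bilinear Y -> V -> R}) (b_bounded : bounded_bilinear b)
    (O : {linear Y -> Z}) (O_bounded : bounded_operator O)
    (D : {linear U -> dual V}) (D_bounded : bounded_operator D)
    (yd : Z) (alpha : R) (alpha_gt0 : 0 < alpha)
    (b_inf_sup : exists2 Cb : R, 0 < Cb & inf_sup b Cb)
    (b_nondegenerate : nondegenerate_right b) :
  exists! p : Y * U, minimizer (cost O yd alpha) (admissible Uad b D) p.
Proof.
have [Cb Cb0 bCb] := b_inf_sup.
have [S S_bounded SE] :=
  solution_operator b_bounded Cb0 bCb b_nondegenerate D_bounded.
pose J u := cost O yd alpha (S u, u).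
have J_cont : continuous J.
  move=> u; apply: cvgD; apply: cvgMl_tmp; apply: cvg_sqr_norm => //.
  apply: cvgB; last exact: cvg_cst.
  by apply: (continuous_comp (f := S) (g := O)); exact: bounded_operator_continuous.
have [u [[Uu u_min] u_uniq]] : exists! u, minimizer J Uad u.
  (* The constant is the weight [alpha / 2] times the [1 / 4] of the parallelogram law; the bound 0
     holds since the cost is a sum of squares. *)
  apply: (@strongly_convex_minimizer _ _ _ J (alpha / 8) 0) => //.
  - by rewrite divr_gt0.
  - move=> x _; rewrite /J /cost.
    by rewrite addr_ge0// mulr_ge0 ?divr_ge0 ?sqr_ge0// ltW.
  move=> x y Ux Uy; split; first exact: convex_midpoint.
  (* The residual is affine in the control, so it commutes with midpoints. *)
  have OSE : O (S (2^-1 *: (x + y))) - yd =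
      2^-1 *: ((O (S x) - yd) + (O (S y) - yd)).
    have -> : O (S (2^-1 *: (x + y))) = 2^-1 *: (O (S x) + O (S y)).
      by rewrite [S (_ *: _)]linearZ [ O (_ *: _)]linearZ
                 [S (_ + _)]linearD [ O (_ + _)]linearD.
    rewrite addrACA [in RHS]scalerDr -opprD scalerN; congr (_ - _).
    by rewrite -mulr2n -[yd *+ 2]scaler_nat scalerA mulVf// scale1r.
  rewrite /J /cost /= OSE !sqr_norm_midpoint.
  (* The convexity gap of the observation term is only needed to be nonnegative. *)
  have := sqr_ge0 `|O (S x) - yd - (O (S y) - yd)|.
  by lra.
have adm_S w : Uad w -> admissible Uad b D (S w, w).
  by move=> Uw; split=> //; apply/SE.
exists (S u, u); split.
  split; first exact: adm_S.
  by move=> [y w] [/= Uw /SE ->]; exact: u_min.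
(* A minimising pair has the form [(S w, w)]; comparing it with the pairs [(S z, z)] shows that [w]
   minimises the reduced cost. *)
move=> [y w] [[/= Uw /SE ->] w_min].
have -> // : u = w.
apply: u_uniq; split=> // z Uz; exact: (w_min (S z, z) (adm_S z Uz)).
Qed.
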